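(* Suppose that $q\in(0,1)$, and that $a\neq0$ and $b$ are real numbers with $b<0$ and $|b|>|a|$, and put $\kappa=-\log|b/a|/\log(1/q)$. Let $\varphi\in C([0,\infty);\mathbb{R})$, let $\xi\in\mathbb{R}$, and let $z$ be the unique continuous solution of $$z'(t)=az(qt)+bz(t)+\varphi(t),\quad t\ge0;\qquad z(0)=\xi.$$ Let $\varphi(t)=O(\gamma(t))$ as $t\to\infty$, where $\gamma$ is regularly varying at infinity. Then $$z(t)=O\left(t^\kappa\int_1^t\frac{\gamma(s)}{s^{\kappa+1}}\,ds\right),\quad t\to\infty.$$
   Context: A measurable function $\gamma:[0,\infty)\to(0,\infty)$ is regularly varying at infinity if there is an index $\eta\in\mathbb{R}$ with $\lim_{t\to\infty}\gamma(\lambda t)/\gamma(t)=\lambda^\eta$ for every $\lambda>0$. Integrals of positive functions are understood with values in $[0,\infty]$. *)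

(* Defs.v *)
From HB Require Import structures.
From mathcomp Require Import all_boot all_order all_algebra.
From mathcomp Require Import all_classical all_reals all_analysis.

Set Implicit Arguments.
Unset Strict Implicit.
Unset Printing Implicit Defensive.

Import Order.TTheory GRing.Theory Num.Theory.
Import numFieldNormedType.Exports.

Local Open Scope classical_set_scope.
Local Open Scope ring_scope.

(* A function on [0, +oo) is a total
   function R -> R; its values on negative arguments are never constrained. *)

(* R with the sigma-algebra of Lebesgue measurable sets, which is the domain of
   completed_lebesgue_measure; measurableTypeR R only has the Borel sets. *)
Notation lebesgueTypeR R :=
  (caratheodory_type ((@wlength R idfun)^* )%mu) (only parsing).

Definition lebesgue_measurable_fun (R : realType) (D : set R) (f : R -> R) :=
  @measurable_fun _ _ (lebesgueTypeR R) (measurableTypeR R) D f.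

Definition regularly_varying (R : realType) (g : R -> R) :=
  [/\ forall t : R, 0 <= t -> 0 < g t,
      lebesgue_measurable_fun `[0, +oo[ g
    & exists eta : R, forall lambda : R, 0 < lambda ->
        g (lambda * t) / g t @[t --> +oo] --> lambda `^ eta].

(* Lets the library notation =O_+oo infer that +oo is a filter. *)
Canonical pinfty_filter_on (R : numFieldType) :=
  FilterType (pinfty_nbhs R) proper_pinfty_nbhs.

(* f(t) = O(g(t)) as t -> +oo for a bound g with values in [0, +oo], which
   =O_+oo does not allow. *)
Definition ebigO (R : realType) (f : R -> R) (g : R -> \bar R) :=
  exists2 C : R, 0 < C & \forall t \near +oo, (`|f t|%:E <= C%:E * g t)%E.

(* At t = 0 the derivative is the right derivative. *)
Definition pantograph_solution (R : realType) (q a b : R) (phi : R -> R)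
    (xi : R) (z : R -> R) :=
  [/\ {within `[0, +oo[, continuous z},
      z 0 = xi,
      forall t : R, 0 < t -> is_derive t 1 z (a * z (q * t) + b * z t + phi t)
    & (z h - z 0) / h @[h --> 0^'+] --> a * z (q * 0) + b * z 0 + phi 0].

Definition kappa (R : realType) (q a b : R) : R :=
  - (ln `|b / a| / ln (1 / q)).

(* Main.v *)
Require Import Defs.
From mathcomp Require Import all_boot all_order all_algebra ring lra.
From mathcomp Require Import all_classical all_reals all_analysis.
From mathcomp Require Import measurable_realfun.

Import Order.TTheory GRing.Theory Num.Theory.
Import numFieldNormedType.Exports.

Local Open Scope classical_set_scope.
Local Open Scope ring_scope.

(** Write [kap] for the exponent [kappa q a b], characterized by
    [`|a| * q `^ kap = `|b|] (lemma [powR_kappa]), put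
    [h s = gamma s / s `^ (kap + 1)] and let [G t] be the integral of [h] over
    [[1, t]]. The claim is that [z t] is bounded by a multiple of
    [t `^ kap * G t].

    If [z t = t `^ kap * w t], the two linear terms of the equation combine,
    up to signs, into [`|b| * t `^ kap * (w t - w (q * t))]. So
    [t `^ kap * W t] dominates [`|z|] as soon as [W] is nondecreasing and
    [`|b| * (W t - W (q * t))] exceeds [t `^ (- kap) * `|phi t|] plus the small
    error [- kap * W t / t] that comes from differentiating the power. The
    lemma [pantograph_comparison] makes this precise by a first-crossing
    argument in which all that matters about [W] is monotonicity and this
    inequality.

    A multiple of [G] nearly has this property. By
    [pointwise_scaling_limit_le_integral], a consequence of Fatou's lemma and
    of the substitution rule [completed_lebesgue_integral_scale], regular
    variation gives [G t - G (q * t) >= c * t * h t] for large [t], and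
    [t * h t] is exactly [t `^ (- kap) * gamma t], so the increments of [G]
    dominate the forcing. The error [- kap * W t / t] is absorbed by taking
    [W t = K * (G t * (2 - m / t))] with suitable constants [K] and [m]; this
    is [pantograph_growth].

    Once [G] is infinite there is nothing to prove, so all this is done with
    [G] finite. *)

(** * Scaling of the completed Lebesgue measure *)

Notation lebesgue_outer R := ((@wlength R idfun)^*)%mu.

Lemma preimage_mulr_itvoc {R : realType} (c u v : R) : 0 < c ->
  *%R c @^-1` `]u, v] = `]u / c, v / c]%classic.
Proof.
move=> c0; apply/seteqP; split => x /=; rewrite !in_itv/=;
  by rewrite ltr_pdivrMr// ler_pdivlMr// mulrC.
Qed.

(** Dilating an interval cover of [A] by [1 / c] gives an interval cover of its
    preimage under multiplication by [c], and every length is divided by [c]. *)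
Lemma lebesgue_outer_scale_le {R : realType} {c : R} (A : set R) : 0 < c ->
  (lebesgue_outer R ( *%R c @^-1` A) <= c^-1%:E * lebesgue_outer R A)%E.
Proof.
move=> c0; rewrite -[leLHS]mul1e -(@divff _ c) ?gt_eqF// mulrC EFinM -muleA.
rewrite lee_pmul2l ?lte_fin ?invr_gt0//.
apply: le_ereal_inf_tmp => _ [B [mB AB] <-].
rewrite muleC -lee_pdivlMr// muleC.
rewrite -nneseriesZl; last by move=> i _; exact: wlength_ge0.
apply: ereal_inf_lbound; exists (fun k => *%R c @^-1` B k).
  split.
    move=> k; have [[u v] _ <-] := mB k.
    by rewrite preimage_mulr_itvoc//; exact: is_ocitv.
  by rewrite -preimage_bigcup; exact: preimage_subset.
apply: eq_eseriesr => k _; have [[u v] _ <-] := mB k.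
rewrite preimage_mulr_itvoc// !wlength_itv/= !lte_fin ltr_pM2r ?invr_gt0//.
case: ifPn => _; last by rewrite mule0.
by rewrite -!EFinB -EFinM mulrBr ![c^-1 * _]mulrC.
Qed.

(** The inequality for [c] and the one for [1 / c] together give equality. *)
Lemma lebesgue_outer_scale {R : realType} {c : R} (A : set R) : 0 < c ->
  lebesgue_outer R ( *%R c @^-1` A) = (c^-1%:E * lebesgue_outer R A)%E.
Proof.
move=> c0; apply/eqP; rewrite eq_le lebesgue_outer_scale_le//=.
rewrite muleC lee_pdivrMr// muleC.
have c'0 : 0 < c^-1 by rewrite invr_gt0.
have := lebesgue_outer_scale_le ( *%R c @^-1` A) c'0.
rewrite invrK -comp_preimage.
rewrite (_ : *%R c \o _ = id) ?preimage_id//.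
by apply/funext => x /=; rewrite mulrA divff ?gt_eqF// mul1r.
Qed.

(** Multiplication by [c] is Borel measurable, but here the target also carries
    the Lebesgue sigma-algebra, so preimages of null sets must be handled: the
    Caratheodory condition is transported by the scaling of the outer
    measure. *)
Lemma measurable_mulr_lebesgue {R : realType} {c : R} : 0 < c ->
  measurable_fun [set: lebesgueTypeR R] ( *%R c : lebesgueTypeR R -> lebesgueTypeR R).
Proof.
move=> c0 _ A mA; rewrite setTI.
suff : caratheodory_measurable (lebesgue_outer R) ( *%R c @^-1` A) by [].
move=> X.
have {}mA Y : lebesgue_outer R Y =
    (lebesgue_outer R (Y `&` A) + lebesgue_outer R (Y `&` ~` A))%E := mA Y.
have cK : X = *%R c @^-1` ( *%R c^-1 @^-1` X).
  rewrite -comp_preimage (_ : _ \o _ = id) ?preimage_id//.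
  by apply/funext => x /=; rewrite mulrA mulVf ?gt_eqF// mul1r.
move: ( *%R c^-1 @^-1` X) cK => Y ->.
rewrite preimage_setC -(preimage_setI _ Y A) -(preimage_setI _ Y (~` A)).
rewrite (lebesgue_outer_scale Y c0) (lebesgue_outer_scale (Y `&` A) c0).
rewrite (lebesgue_outer_scale (Y `&` ~` A) c0) [in LHS]mA.
by rewrite ge0_muleDr//; exact: outer_measure_ge0.
Qed.

(** The substitution [y = c * x] for functions that are only Lebesgue
    measurable: the image of the measure under multiplication by [c] is the
    measure divided by [c]. *)
Lemma completed_lebesgue_integral_scale {R : realType} (c u v : R) (f : R -> R) :
  0 < c -> lebesgue_measurable_fun `]u, v] f ->
  (forall x : R, u < x -> 0 <= f x) ->
  (\int[@completed_lebesgue_measure R]_(x in (`](u / c)%R, (v / c)%R] : set R)) (f (c * x)%R)%:E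
  = c^-1%:E * \int[@completed_lebesgue_measure R]_(x in (`]u, v] : set R)) (f x)%:E)%E.
Proof.
move=> c0 mf f0.
have c'0 : 0 <= c^-1 by rewrite invr_ge0 ltW.
have mD : measurable (`]u, v]%classic : set (lebesgueTypeR R)).
  by apply: sub_caratheodory; apply: measurable_itv.
have mfE := (measurable_EFinP _ _).2 mf.
have pos x : `]u, v]%classic x -> (0 <= (EFin \o f) x)%E.
  by rewrite /= in_itv/= => /andP[? _]; rewrite lee_fin f0.
rewrite -preimage_mulr_itvoc//.
have := @ge0_integral_pushforward _ _ (lebesgueTypeR R) (lebesgueTypeR R) R
  ( *%R c) (measurable_mulr_lebesgue c0) (@completed_lebesgue_measure R) _
  (EFin \o f) mD mfE.
move=> <-; last by move=> y /[!inE]; exact: pos.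
(* the factor [c^-1] is read as a scaling of the measure *)
rewrite -[c^-1]/((NngNum c'0)%:num) -ge0_integral_mscale//.
apply: eq_measure_integral => [|mscale_meas A _ _].
  exact: measurable_mulr_lebesgue.
exact: lebesgue_outer_scale.
Qed.

(** * Integrals of functions with pointwise scaling limits *)

Lemma completed_lebesgue_measure_itvoc {R : realType} (u v : R) : u <= v ->
  completed_lebesgue_measure (`]u, v] : set R) = (v - u)%:E.
Proof.
move=> uv; rewrite /completed_lebesgue_measure /=.
rewrite /completed_lebesgue_stieltjes_measure/= /completed_measure_extension/=.
rewrite measurable_mu_extE//; last exact: is_ocitv.
exact: (wlength_itv_bnd idfun).
Qed.

Lemma measurable_itv_lebesgue {R : realType} (i : interval R) :
  measurable ([set` i] : set (lebesgueTypeR R)).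
Proof. by apply: sub_caratheodory; exact: measurable_itv. Qed.

(** Substituting [s = t * x] turns the claim into a positive lower bound, for
    large [t], on the integral over [x] in ]q, 1] of [h (t * x) / h t]. If there
    were none, these integrals would tend to 0 along some sequence [t n] going
    to infinity, and Fatou's lemma would give [l] a zero integral over ]q, 1],
    although [l] is positive there. *)
Lemma pointwise_scaling_limit_le_integral {R : realType} (q : R) (h l : R -> R) :
  0 < q -> q < 1 -> lebesgue_measurable_fun `]0, +oo[ h ->
  (forall t, 0 < t -> 0 < h t) -> (forall x, 0 < x -> 0 < l x) ->
  (forall x, 0 < x -> (fun t : R => h (x * t) / h t) @ +oo --> l x) ->
  exists2 c : R, 0 < c & \forall t \near +oo,
    ((c * (t * h t))%:E <=
       \int[@completed_lebesgue_measure R]_(s in (`](q * t)%R, t] : set R)) (h s)%:E)%E.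
Proof.
move=> q0 q1 mh h0 l0 hl; apply: contrapT => noc.
have {noc} small n : exists t : R, n.+1%:R < t /\
    (\int[@completed_lebesgue_measure R]_(s in (`](q * t)%R, t] : set R)) (h s)%:E
       < (n.+1%:R^-1 * (t * h t))%:E)%E.
  apply: contrapT => /forallNP nt; apply: noc; exists n.+1%:R^-1.
    by rewrite invr_gt0.
  exists n.+1%:R; split; first exact: num_real.
  by move=> t nt'; have /not_andP[//|/negP] := nt t; rewrite -leNgt.
have [t /all_and2[t_gt int_small]] := choice small.
have t_gt0 n : 0 < t n by rewrite (lt_trans _ (t_gt n)).
have t_oo : t n @[n --> \oo] --> +oo.
  apply/cvgryPge => M; near=> n.
  rewrite (le_trans _ (ltW (t_gt n)))// (@le_trans _ _ n%:R)//; last first.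
    by rewrite ler_nat.
  by near: n; exact: nbhs_infty_ger.
pose D : set (lebesgueTypeR R) := `]q, 1]%classic.
have mD : measurable D by exact: measurable_itv_lebesgue.
have D0 x : D x -> 0 < x by rewrite /D/= in_itv/= => /andP[/(lt_trans q0)].
pose F n (x : lebesgueTypeR R) := (h (t n * x) / h (t n))%:E.
have F_cvg x : D x -> F n x @[n --> \oo] --> (l x)%:E.
  move=> /D0 x0; apply: cvg_EFin; first by apply: nearW.
  have /cvg_pinftyP/(_ t t_oo) := hl _ x0.
  rewrite (_ : _ \o _ = fun n => h (x * t n) / h (t n))//.
  by apply/funext => n; rewrite /= (mulrC x).
have mF n : measurable_fun D (F n).
  apply/measurable_EFinP/measurable_funM; last exact: measurable_cst.
  apply: (measurable_comp (F := `]0, +oo[%classic : set (lebesgueTypeR R))) mh _.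
  - exact: measurable_itv_lebesgue.
  - by move=> _ [x /D0 x0 <-] /=; rewrite in_itv/= andbT mulr_gt0.
  - exact: measurable_funS (measurable_mulr_lebesgue (t_gt0 n)).
have intF n : (\int[@completed_lebesgue_measure R]_(x in D) F n x <= n.+1%:R^-1%:E)%E.
  have It_gt0 (x : R) : q * t n < x -> 0 < x.
    exact/lt_trans/mulr_gt0/t_gt0.
  have mht : lebesgue_measurable_fun `](q * t n), (t n)] h.
    apply: measurable_funS mh; first exact: measurable_itv_lebesgue.
    by move=> x /=; rewrite !in_itv/= andbT => /andP[/It_gt0].
  have := @completed_lebesgue_integral_scale R (t n) (q * t n) (t n)
     (fun s => h s / h (t n)) (t_gt0 n).
  rewrite mulfK ?gt_eqF// divff ?gt_eqF// => ->; last 2 first.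
  - by apply: measurable_funM; [exact: mht|exact: measurable_cst].
  - by move=> x /It_gt0 x0; rewrite ltW// divr_gt0// h0.
  under eq_integral do rewrite EFinM.
  rewrite (ge0_integralZr _ (measurable_itv_lebesgue _)); last 3 first.
  - exact/measurable_EFinP.
  - by move=> x /=; rewrite in_itv/= => /andP[/It_gt0 x0 _]; rewrite lee_fin ltW// h0.
  - by rewrite lee_fin invr_ge0 ltW// h0.
  rewrite muleC -muleA -EFinM -lee_pdivlMr ?mulr_gt0 ?invr_gt0 ?h0//.
  by rewrite invfM !invrK -EFinM [h _ * _]mulrC ltW.
have F0 n x : D x -> (0 <= F n x)%E.
  by move=> /D0 x0; rewrite lee_fin divr_ge0// ltW// h0// mulr_gt0.
have ml : measurable_fun D (EFin \o l).
  by apply: (emeasurable_fun_cvg F) => // x /F_cvg.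
have int_l0 : (\int[@completed_lebesgue_measure R]_(x in D) (l x)%:E = 0)%E.
  apply/eqP; rewrite eq_le; apply/andP; split; last first.
    by apply: integral_ge0 => x /D0 x0; rewrite lee_fin ltW// l0.
  have -> : (\int[@completed_lebesgue_measure R]_(x in D) (l x)%:E =
      \int[@completed_lebesgue_measure R]_(x in D) limn_einf (F^~ x))%E.
    by apply: eq_integral => x /[!inE] /F_cvg /cvg_limn_einf_sup[].
  apply: le_trans (fatou _ mD mF F0) _.
  have /cvg_limn_einf_sup[-> _]// :
    (\int[@completed_lebesgue_measure R]_(x in D) F n x)%E @[n --> \oo] --> 0%:E.
  apply: (@squeeze_cvge _ _ _ _ (cst 0%:E) _ (fun n => (n.+1%:R^-1)%:E)).
  - by apply: nearW => n; rewrite intF andbT integral_ge0//; exact: F0.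
  - exact: cvg_cst.
  - by apply: cvg_EFin; [exact: nearW|exact: cvg_harmonic].
have int_abs_l0 :
    (\int[@completed_lebesgue_measure R]_(x in D) `|(EFin \o l) x| = 0)%E.
  rewrite -int_l0; apply: eq_integral => x /[!inE] /D0 x0 /=.
  by rewrite ger0_norm// ltW// l0.
have [N [mN N0 DN]] := (ae_eq_integral_abs _ mD ml).1 int_abs_l0.
have : (completed_lebesgue_measure D <= completed_lebesgue_measure N)%E.
  rewrite le_measure ?inE// => x Dx; apply: DN => /(_ Dx) /= /eqP.
  by rewrite eqe gt_eqF// l0// D0.
by rewrite N0 (completed_lebesgue_measure_itvoc _ _ (ltW q1)) lee_fin subr_le0 leNgt q1.
Unshelve. all: by end_near. Qed.

(** * A comparison principle for the pantograph equation *)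

(** If [P] failed somewhere, the infimum of the points where it fails would
    satisfy [P] by the first hypothesis, and the second would then push the
    infimum further to the right. *)
Lemma half_line_induction {R : realType} (T : R) (P : R -> Prop) :
  (forall t, T <= t -> (forall s, T <= s -> s < t -> P s) -> P t) ->
  (forall t, T <= t -> (forall s, T <= s -> s <= t -> P s) ->
    \forall s \near t^'+, P s) ->
  forall t, T <= t -> P t.
Proof.
move=> left right t0 Tt0; apply: contrapT => nPt0.
pose S := [set t | T <= t /\ ~ P t].
have S0 : S !=set0 by exists t0.
have lbS : has_lbound S by exists T => t [].
have Tinf : T <= inf S by apply: lb_le_inf => // t [].
have before s : T <= s -> s < inf S -> P s.
  move=> Ts sinf; apply: contrapT => nPs.
  by have := ge_inf lbS (conj Ts nPs : S s); rewrite leNgt sinf.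
have at_inf := left _ Tinf before.
have upto s : T <= s -> s <= inf S -> P s.
  by move=> Ts; rewrite le_eqVlt => /predU1P[->//|]; exact: before.
have [e /= e0 He] := right _ Tinf upto.
have [s [Ts nPs] s_lt] := inf_adherent e0 (conj S0 lbS).
apply: nPs; have [|inf_s] := leP s (inf S); first exact: upto.
by apply: He => //=; rewrite ltr0_norm ?subr_lt0// opprB ltrBlDl.
Qed.

Lemma is_derive_cvg {R : realType} {f : R -> R} {t d : R} :
  is_derive t 1 f d -> f s @[s --> t] --> f t.
Proof. by move=> fd; apply/differentiable_continuous/derivable1_diffP. Qed.

(** What makes a barrier argument work: where [u] touches 0 it must be strictly
    increasing, so it cannot become negative just to the right. *)
Lemma near_right_ge0 {R : realType} (u : R -> R) (t d : R) :
  is_derive t 1 u d -> 0 <= u t -> (u t = 0 -> 0 < d) ->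
  \forall s \near t^'+, 0 <= u s.
Proof.
move=> ud; rewrite le_eqVlt => /predU1P[ut0|ut_gt0 _]; last first.
  have /cvgr_gt/(_ _ ut_gt0) uge0 := is_derive_cvg ud; apply: cvg_within.
  by near=> s; apply: ltW; near: s.
move=> /(_ (esym ut0)) d0.
have : h^-1 *: (u (h *: 1 + t) - u t) @[h --> 0^'] --> d.
  by rewrite -(@derive_val _ _ _ _ _ _ _ ud); exact: (@ex_derive _ _ _ _ _ _ _ ud).
move=> /cvgr_gt/(_ _ d0)[e /= e0 He].
exists e => //= s /= st ts.
have ts0 : 0 < s - t by rewrite subr_gt0.
have := He (s - t); rewrite /= sub0r normrN distrC => /(_ st).
rewrite gt_eqF// => /(_ isT).
by rewrite scaler1 subrK -ut0 subr0 pmulr_rgt0 ?invr_gt0// => /ltW.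
Unshelve. all: by end_near. Qed.

(** [t `^ kap * W t] is a supersolution of the equation satisfied by [`|z|].
    Monotonicity of [W] takes the place of differentiability: just after a
    point [t] the barrier lies above the smooth function [s `^ kap * W t] of
    [s], which touches it at [t], and just before [t] it lies below that
    function. The condition [`|a| * q `^ kap = `|b|] says
    that powers of exponent [kap] balance the two linear terms, which leaves
    [W t - W (q * t)] to absorb [phi] and the derivative of the power. *)
Lemma pantograph_comparison {R : realType} {q a b kap T : R} {phi z W : R -> R} :
  0 < q -> q < 1 -> b < 0 -> `|a| * q `^ kap = `|b| -> 0 < T ->
  (forall t, T <= t -> is_derive t 1 z (a * z (q * t) + b * z t + phi t)) ->
  (forall s t, q * T <= s -> s <= t -> W s <= W t) ->
  (forall t, T <= t ->
    `|phi t| < t `^ kap * (`|b| * (W t - W (q * t)) + kap * W t / t)) ->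
  (forall t, q * T <= t -> t <= T -> `|z t| <= t `^ kap * W t) ->
  forall t, T <= t -> `|z t| <= t `^ kap * W t.
Proof.
move=> q0 q1 b0 aqb T0 dz Wmono phi_lt z_init.
have qTT : q * T <= T by rewrite ger_pMl// ltW.
(* stated for arbitrary [y] and [psi], to be used for [z] and for [- z] *)
have right_bound (y psi : R -> R) t : T <= t ->
    is_derive t 1 y (a * y (q * t) + b * y t + psi t) ->
    `|psi t| < t `^ kap * (`|b| * (W t - W (q * t)) + kap * W t / t) ->
    `|y (q * t)| <= (q * t) `^ kap * W (q * t) ->
    y t <= t `^ kap * W t ->
    \forall s \near t^'+, 0 <= s `^ kap * W t - y s.
  move=> Tt dy psi_lt yq yt.
  have t0 : 0 < t by exact: lt_le_trans Tt.
  have dpow := @is_derive1_powR R kap t t0.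
  apply: (@near_right_ge0 _ (fun s => s `^ kap * W t - y s) t) => [|yt_eq].
    by rewrite subr_ge0.
  rewrite /= scaler0 add0r /GRing.scale/=.
  have -> : t `^ (kap - 1) = t `^ kap / t.
    by rewrite powRB ?powRr1 ?(ltW t0)// (gt_eqF t0) implybT.
  have ayq : a * y (q * t) <= `|b| * (t `^ kap * W (q * t)).
    rewrite (le_trans (ler_norm _))// normrM -aqb -!mulrA ler_wpM2l//.
    by rewrite mulrA -powRM// ltW.
  have yt' : y t = t `^ kap * W t by apply/esym/eqP; rewrite -subr_eq0 yt_eq.
  have psi_le := ler_norm (psi t).
  have byt : b * y t = - (`|b| * (t `^ kap * W t)).
    by rewrite yt' ltr0_norm// mulNr opprK.
  rewrite byt.
  lra.
(* closure at [t]: the bound passes to the limit from the left *)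
apply: half_line_induction => t Tt hist.
  have t0 : 0 < t by exact: lt_le_trans Tt.
  move: Tt; rewrite le_eqVlt => /predU1P[<-|Tt]; first exact: z_init.
  have left_bound : \forall s \near t^'-, `|z s| <= s `^ kap * W t.
    near=> s.
    have Ts : T <= s by near: s; exact: nbhs_left_ge.
    have st : s < t by near: s; exact: nbhs_left_lt.
    rewrite (le_trans (hist s Ts st))// ler_wpM2l ?powR_ge0//.
    exact: Wmono (le_trans qTT Ts) (ltW st).
  apply: ler_cvg_to left_bound; apply: cvg_at_left_filter.
    apply: cvg_norm.
    exact: is_derive_cvg (dz t (ltW Tt)).
  apply: cvgM; last exact: cvg_cst.
  exact: is_derive_cvg (is_derive1_powR _ t0).
(* continuation past [t] *)
have zq : `|z (q * t)| <= (q * t) `^ kap * W (q * t).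
  have [qtT|/ltW Tqt] := leP (q * t) T; first by rewrite z_init// ler_pM2l.
  by apply: hist => //; rewrite ger_pMl ?(lt_le_trans T0)// ltW.
have /andP[ztN zt] : - (t `^ kap * W t) <= z t <= t `^ kap * W t.
  by rewrite -ler_norml hist.
have up := right_bound z phi t Tt (dz t Tt) (phi_lt t Tt) zq zt.
have lo : \forall s \near t^'+, 0 <= s `^ kap * W t - - z s.
  apply: (right_bound (fun s => - z s) (fun s => - phi s)) => //.
  - have := dz t Tt => dzt.
    by apply: is_derive_eq; rewrite mulrN mulrN !opprD.
  - by rewrite normrN phi_lt.
  - by rewrite normrN.
  - by rewrite lerNl.
near=> s.
have ts : t < s by near: s; exact: nbhs_right_gt.
apply: (@le_trans _ _ (s `^ kap * W t)).
  have us : 0 <= s `^ kap * W t - z s by near: s.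
  have ls : 0 <= s `^ kap * W t - - z s by near: s.
  by rewrite ler_norml; apply/andP; split; lra.
rewrite ler_wpM2l ?powR_ge0//.
exact: Wmono (le_trans qTT Tt) (ltW ts).
Unshelve. all: by end_near. Qed.

(** The comparison function is [W t = K * (g t * (2 - m / t))]. The forcing is
    paid for by the increments of [g] once [K] is large. The factor
    [2 - m / t], which lies between 1 and 2 for [t >= m], increases just enough to pay for
    the derivative of [t `^ kap]: its increment between [q * t] and [t] is
    [m * (1 / q - 1) / t], and this beats [2 * `|kap| / (`|b| * t)] by the
    choice of [m]. *)
Lemma pantograph_growth {R : realType} {q a b kap A T0 : R} {phi z g : R -> R} :
  0 < q -> q < 1 -> b < 0 -> `|a| * q `^ kap = `|b| -> 0 < A -> 0 < T0 ->
  (forall t : R, 0 < t -> is_derive t 1 z (a * z (q * t) + b * z t + phi t)) ->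
  (forall s t, T0 <= s -> s <= t -> g s <= g t) ->
  (forall t, T0 <= t -> 0 < g t) ->
  (forall t, T0 <= q * t -> `|phi t| <= t `^ kap * (A * (g t - g (q * t)))) ->
  exists2 C, 0 < C & forall t, C <= t -> `|z t| <= C * (t `^ kap * g t).
Proof.
move=> q0 q1 b0 aqb A0 T0_gt0 dz g_mono g_gt0 phi_le.
have qV1 : 0 < q^-1 - 1 by rewrite subr_gt0 invf_gt1.
have nb0 : 0 < `|b| by rewrite normr_gt0 lt_eqF.
pose m := 2 * `|kap| / (`|b| * (q^-1 - 1)) + 1.
have m0 : 0 < m.
  by rewrite ltr_wpDl// divr_ge0 ?mulr_ge0// ltW.
pose T := Num.max T0 m / q.
have qT : q * T = Num.max T0 m by rewrite mulrC divfK ?gt_eqF.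
have T0qT : T0 <= q * T by rewrite qT le_max lexx.
have mqT : m <= q * T by rewrite qT le_max lexx orbT.
have qT_gt0 : 0 < q * T by exact: lt_le_trans T0qT.
have T_gt0 : 0 < T by rewrite -(pmulr_rgt0 _ q0).
have qTT : q * T <= T by rewrite ger_pMl// ltW.
have [c _ z_max] : exists2 c, c \in `[q * T, T] & forall t, t \in `[q * T, T] ->
    `|z t| * t `^ (- kap) <= `|z c| * c `^ (- kap).
  apply: (@EVT_max _ (fun t => `|z t| * t `^ (- kap))) => //.
  apply: continuous_in_subspaceT => t; rewrite inE/= in_itv/= => /andP[qTt _].
  have t0 : 0 < t by exact: lt_le_trans qTt.
  apply: cvgM; first by apply: cvg_norm; exact: is_derive_cvg (dz t t0).
  exact: is_derive_cvg (is_derive1_powR _ t0).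
(* the first summand of [K] settles the initial interval [q * T, T], the
   second one the forcing *)
pose K := `|z c| * c `^ (- kap) / g (q * T) + A / `|b|.
have K_ge : `|z c| * c `^ (- kap) <= K * g (q * T).
  rewrite mulrDl divfK ?gt_eqF ?g_gt0// lerDl.
  by rewrite mulr_ge0 ?divr_ge0// ltW// g_gt0.
have AK : A <= `|b| * K.
  rewrite mulrDr [_ * (A / _)]mulrC divfK ?gt_eqF// lerDr.
  by rewrite mulr_ge0// mulr_ge0 ?mulr_ge0 ?powR_ge0// invr_ge0 ltW// g_gt0.
have K0 : 0 < K by rewrite -(pmulr_rgt0 _ nb0); exact: lt_le_trans AK.
pose W t := K * (g t * (2 - m / t)).
have mt_le1 t : q * T <= t -> 0 < m / t <= 1.
  move=> qTt; have t0 := lt_le_trans qT_gt0 qTt.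
  by rewrite divr_gt0//= ler_pdivrMr// mul1r (le_trans mqT).
have W_mono s t : q * T <= s -> s <= t -> W s <= W t.
  move=> qTs st; have qTt := le_trans qTs st.
  have s0 := lt_le_trans qT_gt0 qTs; have t0 := lt_le_trans qT_gt0 qTt.
  have /andP[_ ms] := mt_le1 _ qTs.
  rewrite ler_pM2l// ler_pM//.
  - by rewrite ltW// g_gt0// (le_trans T0qT).
  - by lra.
  - by rewrite g_mono// (le_trans T0qT).
  - by rewrite lerD2l lerN2 ler_pM2l// lef_pV2.
have z_bound : forall t, T <= t -> `|z t| <= t `^ kap * W t.
  apply: (@pantograph_comparison R q a b kap T phi z W) => // [t Tt|t Tt|t qTt tT].
  - exact/dz/lt_le_trans/Tt.
  - have t0 : 0 < t by exact: lt_le_trans Tt.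
    have qTqt : q * T <= q * t by rewrite ler_pM2l.
    have T0qt : T0 <= q * t by exact: le_trans qTqt.
    have qtt : q * t <= t by rewrite ger_pMl// ltW.
    rewrite (le_lt_trans (phi_le t T0qt))// ltr_pM2l ?powR_gt0//.
    have gd : 0 <= g t - g (q * t) by rewrite subr_ge0 g_mono.
    have g0 : 0 < g t by rewrite g_gt0// (le_trans T0qt).
    have /andP[_ r1] := mt_le1 _ qTqt.
    have /andP[r0 r1'] := mt_le1 _ (le_trans qTqt qtt).
    (* the first term pays for the forcing, the second one for the derivative
       of the power *)
    have -> : `|b| * (W t - W (q * t)) =
      `|b| * K * ((g t - g (q * t)) * (2 - m / (q * t))) +
      K * g t / t * (m * (`|b| * (q^-1 - 1))).
      by rewrite /W; field; rewrite !gt_eqF.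
    have -> : m * (`|b| * (q^-1 - 1)) = 2 * `|kap| + `|b| * (q^-1 - 1).
      by rewrite mulrDl mul1r divfK// gt_eqF// mulr_gt0.
    have inc : A * (g t - g (q * t)) <=
        `|b| * K * ((g t - g (q * t)) * (2 - m / (q * t))).
      rewrite ler_pM ?(ltW A0)// ler_peMr//; lra.
    have Kgt : 0 < K * g t / t by rewrite divr_gt0// mulr_gt0.
    have kapW : kap * W t / t = K * g t / t * (kap * (2 - m / t)).
      by rewrite /W; field; rewrite gt_eqF.
    have : 0 < K * g t / t * (2 * `|kap| + `|b| * (q^-1 - 1) + kap * (2 - m / t)).
      rewrite mulr_gt0//.
      have : - `|kap| * 2 <= kap * (2 - m / t).
        have kapN : 0 <= kap + `|kap| by have := ler_norm (- kap); rewrite normrN; lra.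
        have r2 : 0 <= 2 - m / t by lra.
        have := mulr_ge0 kapN r2; have := mulr_ge0 (normr_ge0 kap) (ltW r0); lra.
      have := mulr_gt0 nb0 qV1; lra.
    by rewrite kapW; lra.
  - have t0 : 0 < t by exact: lt_le_trans qTt.
    have /andP[_ r1] := mt_le1 _ qTt.
    rewrite mulrC -ler_pdivrMr ?powR_gt0// -powRN.
    rewrite (le_trans (z_max t _)) ?in_itv/= ?qTt//.
    rewrite (le_trans K_ge)// ler_pM2l// -[leLHS]mulr1 ler_pM//.
    + by rewrite ltW// g_gt0.
    + by rewrite g_mono.
    + lra.
exists (Num.max T (2 * K)); first by rewrite lt_max T_gt0.
move=> t; rewrite ge_max => /andP[Tt _].
have t0 : 0 < t by exact: lt_le_trans Tt.
have /andP[r0 _] := mt_le1 _ (le_trans qTT Tt).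
have g0 : 0 < g t by rewrite g_gt0// (le_trans T0qT) ?(le_trans qTT).
rewrite (le_trans (z_bound t Tt))// [leRHS]mulrCA ler_wpM2l ?powR_ge0//.
apply: (@le_trans _ _ (2 * K * g t)); last first.
  by rewrite ler_wpM2r ?(ltW g0)// le_max lexx orbT.
by rewrite /W [2 * K]mulrC -mulrA ler_pM2l// mulrC ler_pM2r//; lra.
Qed.

(** * Regularly varying forcing *)

Lemma powR_kappa {R : realType} {q a b : R} : 0 < q -> q < 1 -> a != 0 -> b != 0 ->
  `|a| * q `^ kappa q a b = `|b|.
Proof.
move=> q0 q1 a0 b0; have na0 : `|a| != 0 by rewrite normr_eq0.
have lnq : ln q != 0 by rewrite lt_eqF// ln_lt0// q0.
rewrite /powR (gt_eqF q0) /kappa div1r lnV ?posrE//.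
rewrite invrN mulrN opprK divfK// lnK ?posrE ?normr_gt0 ?mulf_neq0 ?invr_neq0//.
by rewrite normrM normfV mulrCA divff// mulr1.
Qed.

Lemma lebesgue_measurable_powR {R : realType} (p : R) (D : set R) :
  lebesgue_measurable_fun D (fun s => s `^ p).
Proof.
apply: (measurable_funS (E := [set: lebesgueTypeR R])); first exact: measurableT.
  exact: subsetT.
by move=> _ B mB; apply: sub_caratheodory; exact: measurable_powR.
Qed.

(** Dividing by a power shifts the index of regular variation; the weighted
    function is the one whose integral appears in the bound. *)
Lemma regularly_varying_weight {R : realType} {gamma : R -> R} (p : R) :
  regularly_varying gamma ->
  let h s := gamma s / s `^ p in
  [/\ lebesgue_measurable_fun `]0, +oo[ h, forall t, 0 < t -> 0 < h t
    & exists2 l : R -> R, forall x, 0 < x -> 0 < l x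
      & forall x, 0 < x -> (fun t : R => h (x * t) / h t) @ +oo --> l x].
Proof.
move=> [gamma_gt0 mgamma [eta gamma_eta]] h.
have h_gt0 t : 0 < t -> 0 < h t.
  by move=> t0; rewrite divr_gt0 ?powR_gt0// gamma_gt0// ltW.
split=> //.
  have -> : h = gamma \* (fun s => s `^ (- p)).
    by apply/funext => s; rewrite /= powRN.
  apply: measurable_funM.
    apply: measurable_funS mgamma; first exact: measurable_itv_lebesgue.
    by move=> x /=; rewrite !in_itv/= !andbT => /ltW.
  exact: lebesgue_measurable_powR.
exists (fun x => x `^ eta / x `^ p).
  by move=> x x0; rewrite divr_gt0 ?powR_gt0.
move=> x x0.
have gamma_lim : (fun t : R => gamma (x * t) / gamma t) @ +oo --> x `^ eta.
  exact: gamma_eta.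
have lim : (fun t : R => gamma (x * t) / gamma t * (x `^ p)^-1) @ +oo -->
    x `^ eta / x `^ p.
  by apply: cvgM gamma_lim _; exact: cvg_cst.
have ratioE : {near +oo, (fun t : R => gamma (x * t) / gamma t * (x `^ p)^-1) =1
                          (fun t : R => h (x * t) / h t)}.
  near=> t.
  have t0 : 0 < t by near: t; exact: nbhs_pinfty_gt.
  have gt0 := gamma_gt0 t (ltW t0).
  rewrite /h powRM ?(ltW x0) ?(ltW t0)//=.
  by field; rewrite !gt_eqF ?powR_gt0.
exact: cvg_trans (near_eq_cvg ratioE) lim.
Unshelve. all: by end_near. Qed.

Lemma completed_lebesgue_integral_itv_split {R : realType} {h : R -> R} (r s t : R) :
  lebesgue_measurable_fun `]0, +oo[ h -> (forall x, 0 < x -> 0 <= h x) ->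
  0 < r -> r <= s -> s <= t ->
  (\int[@completed_lebesgue_measure R]_(x in (`[r, t] : set R)) (h x)%:E =
   \int[@completed_lebesgue_measure R]_(x in (`[r, s] : set R)) (h x)%:E +
   \int[@completed_lebesgue_measure R]_(x in (`]s, t] : set R)) (h x)%:E)%E.
Proof.
move=> mh h0 r0 rs st.
have rtE : `[r, t]%classic = `[r, s]%classic `|` `]s, t]%classic.
  by apply: itv_bndbnd_setU; rewrite bnd_simp.
have rt_gt0 x : `[r, t]%classic x -> 0 < x.
  by rewrite /= in_itv/= => /andP[/(lt_le_trans r0)].
rewrite rtE (ge0_integral_setU _ (measurable_itv_lebesgue _)
  (measurable_itv_lebesgue _)) -?rtE.
- by [].
- apply/measurable_EFinP; apply: measurable_funS mh.
    exact: measurable_itv_lebesgue.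
  by move=> x /rt_gt0 x0; rewrite /= in_itv/= x0.
- by move=> x /rt_gt0 x0; rewrite lee_fin h0.
- rewrite disj_set2E; apply/eqP; rewrite -subset0 => x /= [].
  by rewrite !in_itv/= => /andP[_ xs] /andP[/lt_le_trans/(_ xs)]; rewrite ltxx.
Qed.

Theorem theorem2 (R : realType) (q a b xi : R) (phi gamma z : R -> R)
  (q_gt0 : 0 < q) (q_lt1 : q < 1)
  (a_neq0 : a != 0) (b_lt0 : b < 0) (ab : `|a| < `|b|)
  (phi_cont : {within `[0, +oo[, continuous phi})
  (z_sol : pantograph_solution q a b phi xi z)
  (gamma_rv : regularly_varying gamma)
  (phi_gamma : phi =O_+oo gamma) :
  ebigO z (fun t =>
    (t `^ kappa q a b)%:E *
    \int[@completed_lebesgue_measure R]_(s in (`[1%R, t] : set R))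
      (gamma s / s `^ (kappa q a b + 1))%:E)%E.
Proof.
have [_ _ dz _] := z_sol; have [gamma_gt0 _ _] := gamma_rv.
have aqb := powR_kappa q_gt0 q_lt1 a_neq0 (ltr0_neq0 b_lt0).
set kap := kappa q a b in aqb *.
have [mh h_gt0 [l l_gt0 h_l]] := regularly_varying_weight (kap + 1) gamma_rv.
set h := (fun s => gamma s / s `^ (kap + 1)) in mh h_gt0 h_l *.
pose G t := (\int[@completed_lebesgue_measure R]_(s in (`[1%R, t] : set R)) (h s)%:E)%E.
have G_split s t : 1 <= s -> s <= t -> G t =
    (G s + \int[@completed_lebesgue_measure R]_(x in (`]s, t] : set R)) (h x)%:E)%E.
  move=> s1 st; apply: completed_lebesgue_integral_itv_split => // x x0.
  by rewrite ltW// h_gt0.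
have int_ge0 s t : 1 <= s ->
    (0 <= \int[@completed_lebesgue_measure R]_(x in (`]s, t] : set R)) (h x)%:E)%E.
  move=> s1; apply: integral_ge0 => x /=; rewrite in_itv/= => /andP[sx _].
  by rewrite lee_fin ltW// h_gt0// (lt_trans _ sx)// (lt_le_trans _ s1).
have G_mono s t : 1 <= s -> s <= t -> (G s <= G t)%E.
  by move=> s1 st; rewrite (G_split s t)// leeDl// int_ge0.
have G_ge0 t : (0 <= G t)%E.
  apply: integral_ge0 => x /=; rewrite in_itv/= => /andP[x1 _].
  by rewrite lee_fin ltW// h_gt0// (lt_le_trans _ x1).
(* [gamma] may fail to be locally integrable; if the integral is infinite at some
   [t0], it is infinite from then on and the bound is trivial *)
have [[t0 [t0_ge1 Gt0]]|G_fin] := pselect (exists t, 1 <= t /\ G t = +oo%E).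
  exists 1 => //; exists t0; split; first exact: num_real.
  move=> t t0t; rewrite -/(G t); have -> : G t = +oo%E.
    by apply/eqP; rewrite -leye_eq -Gt0 G_mono// ltW.
  by rewrite mul1e gt0_muley ?leey// lte_fin powR_gt0// (lt_trans _ t0t)// (lt_le_trans _ t0_ge1).
pose g t := fine (G t).
have gE t : 1 <= t -> G t = (g t)%:E.
  move=> t1; rewrite fineK// ge0_fin_numE// ltey; apply/eqP => Gt.
  by apply: G_fin; exists t.
have [c c_gt0 [M [_ h_le]]] :=
  pointwise_scaling_limit_le_integral q h l q_gt0 q_lt1 mh h_gt0 l_gt0 h_l.
have g_incr t : M < t -> 1 <= q * t -> c * (t * h t) <= g t - g (q * t).
  move=> Mt qt1.
  have t0 : 0 < t by rewrite -(pmulr_rgt0 _ q_gt0) (lt_le_trans _ qt1).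
  have qtt : q * t <= t by rewrite ger_pMl// ltW.
  have := leeD2l (G (q * t)) (h_le t Mt).
  rewrite -G_split// gE// (gE t (le_trans qt1 qtt)) -EFinD lee_fin.
  by rewrite lerBrDl.
move/eqO_exP : phi_gamma => [k k_gt0 [M' [_ phi_le]]].
(* [T0] is divided by [q] so that [q * t], and not only [t], exceeds the
   thresholds [1], [M] and [M'] as soon as [T0 <= t] *)
pose T0 := (1 + `|M| + `|M'|) / q.
have T0_gt0 : 0 < T0 by rewrite divr_gt0// !ltr_wpDr.
have T0_le t : T0 <= t -> [/\ 0 < t, 1 <= t, 1 <= q * t, M < t & M' < t].
  move=> T0t; have t0 := lt_le_trans T0_gt0 T0t.
  have qt : 1 + `|M| + `|M'| <= q * t by rewrite mulrC -ler_pdivrMr.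
  have qtt : q * t <= t by rewrite ger_pMl// ltW.
  have M_lt : M < 1 + `|M| + `|M'|.
    by rewrite (le_lt_trans (ler_norm M))// addrAC ltrDr ltr_pwDl.
  have M'_lt : M' < 1 + `|M| + `|M'|.
    by rewrite (le_lt_trans (ler_norm M'))// ltrDr ltr_pwDl.
  have qt1 : 1 <= q * t by rewrite (le_trans _ qt)// -addrA lerDl addr_ge0.
  split=> //; first exact: le_trans qtt.
    exact: lt_le_trans (lt_le_trans M_lt qt) qtt.
  exact: lt_le_trans (lt_le_trans M'_lt qt) qtt.
have g_mono s t : T0 <= s -> s <= t -> g s <= g t.
  move=> /T0_le[_ s1 _ _ _] st.
  by rewrite -lee_fin -!gE ?(le_trans s1)// G_mono.
have g_gt0 t : T0 <= t -> 0 < g t.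
  move=> /T0_le[t0 t1 qt1 Mt _].
  apply: (@lt_le_trans _ _ (c * (t * h t))); first by rewrite mulr_gt0// mulr_gt0// h_gt0.
  rewrite (le_trans (g_incr t Mt qt1))// lerBlDr lerDl.
  by rewrite -lee_fin -gE.
have phi_incr t : T0 <= q * t ->
    `|phi t| <= t `^ kap * (k / c * (g t - g (q * t))).
  move=> T0qt; have [qt0 qt1 _ _ _] := T0_le _ T0qt.
  have t0 : 0 < t by rewrite -(pmulr_rgt0 _ q_gt0).
  have qtt : q * t <= t by rewrite ger_pMl// ltW.
  have [_ _ _ Mt M't] := T0_le t (le_trans T0qt qtt).
  have gammaE : gamma t = t `^ kap * (t * h t).
    rewrite /h powRD ?(gt_eqF t0) ?implybT// powRr1 ?(ltW t0)//.
    by field; rewrite !gt_eqF ?powR_gt0.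
  rewrite (le_trans (phi_le t M't))// gtr0_norm ?gamma_gt0 ?(ltW t0)// gammaE.
  rewrite mulrCA ler_pM2l ?powR_gt0// mulrAC ler_pdivlMr// -mulrA ler_pM2l//.
  by rewrite mulrC g_incr.
have [C C_gt0 z_le] := @pantograph_growth R q a b kap (k / c) T0 phi z g
  q_gt0 q_lt1 b_lt0 aqb (divr_gt0 k_gt0 c_gt0) T0_gt0 dz g_mono g_gt0 phi_incr.
exists C => //; exists (Num.max C 1); split; first exact: num_real.
move=> t; rewrite gt_max => /andP[Ct t1].
by rewrite -/(G t) (gE t (ltW t1)) -!EFinM lee_fin z_le// ltW.
Qed.
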